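(* The FCMJ problem is integer-factorization hard, even when restricted to instances whose hierarchical structure has a single module containing exactly two components (i.e. the tree consists of one root module $0$ with two leaf children, the components $1$ and $2$).
   Context: Notation: $\mathbb{Z}_+$ denotes the set of positive integers, and $\operatorname{lcm}(S)$ is the least common multiple of a finite nonempty set $S\subseteq\mathbb{Z}_+$. **The FCMJ (Frequency-Constrained Maintenance Jobs) problem.** An instance consists of: a finite directed tree $T=(\mathcal{C}\cup\mathcal{M},\mathcal{E})$ with edges oriented away from a root (an arborescence), where the elements of $\mathcal{C}$ (components) are the leaves, the other nodes, forming $\mathcal{M}$, are called modules, and the root $r$ is a module, $r\in\mathcal{M}$; a cycle limit $f_c\in\mathbb{Z}_+$ for each component $c\in\mathcal{C}$; a setup cost $K_c$ for each component $c\in\mathcal{C}$; and a setup cost $K_m$ for each module $m\in\mathcal{M}$. Setup costs are nonnegative rational numbers, and all numbers are encoded in binary. For $m\in\mathcal{M}$, let $C_m\subseteq\mathcal{C}$ be the set of components that are children of $m$ in $T$. The problem is to find cycle times $q_c$, $c\in\mathcal{C}$, solving $$\min\ \sum_{c\in\mathcal{C}}\frac{K_c}{q_c}+\sum_{m\in\mathcal{M}}K_m\sum_{\emptyset\neq C\subseteq C_m}\frac{(-1)^{|C|+1}}{\operatorname{lcm}(\{q_c: c\in C\})}\quad\text{subject to } q_c\le f_c,\ q_c\in\mathbb{Z}_+\ \text{ for all } c\in\mathcal{C}.$$ For one module $0$ with two components $1,2$, this is: minimize $\frac{K_0+K_1}{q_1}+\frac{K_0+K_2}{q_2}-\frac{K_0}{\operatorname{lcm}(q_1,q_2)}$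 subject to $q_1\le f_1$, $q_2\le f_2$, $q_1,q_2\in\mathbb{Z}_+$. **Integer-factorization hardness.** An optimization problem $\Pi$ is integer-factorization hard if there is a polynomial-time algorithm (polynomial in $\log M$) that computes the prime factorization of a given composite number $M$ using one or more oracle calls to an algorithm that solves instances of $\Pi$ (i.e. returns an optimal solution), where each oracle call is counted as $O(1)$ time. *)

(* Defs.v *)
From HB Require Import structures.
From mathcomp Require Import all_boot all_order all_algebra.

Set Implicit Arguments.
Unset Strict Implicit.
Unset Printing Implicit Defensive.

Import Order.TTheory GRing.Theory Num.Theory.

(** * Polynomial-time oracle computation

    The machine model is the logarithmic-cost random-access machine over
    natural numbers, programmed in a structured language: every arithmetic
    operation and every memory access is charged the bit lengths of the numbers
    and addresses that it handles.  Up to a polynomial this is Turing machine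
    time. *)

Definition bitlen (n : nat) : nat := (trunc_log 2 n).+1.

Inductive binop := Add | Sub | Mul | Div | Mod.

Inductive expr :=
  | Const of nat
  | Cell of expr               (* content of the cell with the given address *)
  | Bin of binop & expr & expr.

Inductive command :=
  | Skip
  | Store of expr & expr       (* [Store a e] writes e into the cell a *)
  | Seq of command & command
  | If of expr & command & command
  | While of expr & command
  | Send of expr               (* appends a number to the query tape *)
  | Query                      (* submits the query tape to the oracle *)
  | Receive of expr            (* moves the next answer number to a cell *)
  | Output of expr.            (* appends a number to the output tape *)

(* Subtraction is truncated; [m %/ 0 = 0] and [m %% 0 = m]. *)
Definition binop_fun (o : binop) : nat -> nat -> nat :=
  match o with
  | Add => addn | Sub => subn | Mul => muln | Div => divn | Mod => modn
  end.

Definition memory := nat -> nat.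

Definition write (h : memory) (a v : nat) : memory :=
  fun b => if b == a then v else h b.

Fixpoint eval (h : memory) (e : expr) : nat :=
  match e with
  | Const n => n
  | Cell a => h (eval h a)
  | Bin o e1 e2 => binop_fun o (eval h e1) (eval h e2)
  end.

Fixpoint expr_cost (h : memory) (e : expr) : nat :=
  bitlen (eval h e) +
  match e with
  | Const _ => 0
  | Cell a => expr_cost h a
  | Bin _ e1 e2 => expr_cost h e1 + expr_cost h e2
  end.

(* [calls] is a history of the oracle queries; programs cannot read it. *)
Record state := State {
  mem : memory;
  query : seq nat;
  answer : seq nat;
  output : seq nat;
  calls : seq (seq nat)
}.

Definition oracle := seq nat -> seq nat.

(* [exec O c s t s']: with oracle [O], the program [c] started in state [s]
   halts in state [s'] after time [t].  The submission of a query takes one unit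
   of time; writing the query and reading the answer are charged to [Send] and
   [Receive].  Receiving from an exhausted answer tape yields 0. *)
Inductive exec (O : oracle) : command -> state -> nat -> state -> Prop :=
  | ExecSkip s : exec O Skip s 1 s
  | ExecStore a e h qu an ou ca :
      exec O (Store a e) (State h qu an ou ca)
        (1 + expr_cost h a + expr_cost h e)
        (State (write h (eval h a) (eval h e)) qu an ou ca)
  | ExecSeq c1 c2 s1 s2 s3 t1 t2 :
      exec O c1 s1 t1 s2 -> exec O c2 s2 t2 s3 ->
      exec O (Seq c1 c2) s1 (t1 + t2) s3
  | ExecIf e c1 c2 s t s' :
      exec O (if eval (mem s) e != 0 then c1 else c2) s t s' ->
      exec O (If e c1 c2) s (1 + expr_cost (mem s) e + t) s'
  | ExecWhileDone e c s :
      eval (mem s) e = 0 ->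
      exec O (While e c) s (1 + expr_cost (mem s) e) s
  | ExecWhileStep e c s1 s2 s3 t1 t2 :
      eval (mem s1) e != 0 ->
      exec O c s1 t1 s2 -> exec O (While e c) s2 t2 s3 ->
      exec O (While e c) s1 (1 + expr_cost (mem s1) e + t1 + t2) s3
  | ExecSend e h qu an ou ca :
      exec O (Send e) (State h qu an ou ca) (1 + expr_cost h e)
        (State h (rcons qu (eval h e)) an ou ca)
  | ExecQuery h qu an ou ca :
      exec O Query (State h qu an ou ca) 1
        (State h [::] (O qu) ou (rcons ca qu))
  | ExecReceive a h qu an ou ca :
      exec O (Receive a) (State h qu an ou ca)
        (1 + expr_cost h a + bitlen (head 0 an))
        (State (write h (eval h a) (head 0 an)) qu (behead an) ou ca)
  | ExecOutput e h qu an ou ca :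
      exec O (Output e) (State h qu an ou ca) (1 + expr_cost h e)
        (State h qu an (rcons ou (eval h e)) ca).

(* The input is placed in cell 0; all other cells contain 0. *)
Definition start (n : nat) : state :=
  State (write (fun=> 0) 0 n) [::] [::] [::] [::].

(** * Optimization problems and integer-factorization hardness *)

Record minimization_problem := MinimizationProblem {
  instance : Type;
  solution : instance -> Type;
  feasible : forall x, solution x -> Prop;
  objective : forall x, solution x -> rat;
  encode_instance : instance -> seq nat;
  encode_solution : forall x, solution x -> seq nat
}.

Definition optimal (P : minimization_problem) (x : instance P)
    (q : solution x) : Prop :=
  feasible q /\
  forall q' : solution x, feasible q' -> (objective q <= objective q')%R.

(* An oracle for [P] may return any optimal solution, and may behave arbitrarily
   on inputs that do not encode an instance of [P]. *)
Definition solves (P : minimization_problem) (O : oracle) : Prop :=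
  forall x : instance P, exists q : solution x,
    optimal q /\ O (encode_instance x) = encode_solution q.

Definition restrict (P : minimization_problem) (D : instance P -> Prop) :
    minimization_problem :=
  @MinimizationProblem {x : instance P | D x}
    (fun x => solution (sval x))
    (fun x => @feasible P (sval x))
    (fun x => @objective P (sval x))
    (fun x => encode_instance (sval x))
    (fun x => @encode_solution P (sval x)).

Definition composite (n : nat) : bool := (1 < n) && ~~ prime n.

(* Prime factors are listed with multiplicity, in any order. *)
Definition prime_factorization (n : nat) (s : seq nat) : bool :=
  all prime s && (\prod_(p <- s) p == n).

Definition integer_factorization_hard (P : minimization_problem) : Prop :=
  exists (prog : command) (p : {poly nat}),
  forall O : oracle, solves P O ->
  forall n : nat, composite n ->
  exists (t : nat) (s : state),
    [/\ exec O prog (start n) t s,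
        prime_factorization n (output s),
        t <= (p.[trunc_log 2 n])%R,
        calls s <> [::]
      & forall x, x \in calls s ->
          exists y : instance P, x = encode_instance y].

(** * The FCMJ problem *)

Definition arborescence (n : nat) (e : rel 'I_n) (r : 'I_n) : bool :=
  [forall v, connect e r v] &&
  [forall v, #|[set u | e u v]| == (v != r)].

Definition leaves (n : nat) (e : rel 'I_n) : {set 'I_n} :=
  [set v | [forall w, ~~ e v w]].

(* Cycle limits are only meaningful at the leaves. *)
Record fcmj_instance := FcmjInstance {
  node_count : nat;
  edge : rel 'I_node_count;
  root : 'I_node_count;
  cycle_limit : 'I_node_count -> nat;
  setup_cost : 'I_node_count -> rat;
  _ : arborescence edge root;
  _ : root \notin leaves edge;
  _ : forall c, c \in leaves edge -> 0 < cycle_limit c;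
  _ : forall v, (0 <= setup_cost v)%R
}.

Section Fcmj.

Variable x : fcmj_instance.

Definition components : {set 'I_(node_count x)} := leaves (@edge x).

Definition modules : {set 'I_(node_count x)} := ~: components.

Definition child_components (m : 'I_(node_count x)) :
    {set 'I_(node_count x)} :=
  [set c in components | edge m c].

(* Cycle times are only meaningful at the components. *)
Definition cycle_times := 'I_(node_count x) -> nat.

Definition fcmj_feasible (q : cycle_times) : Prop :=
  forall c, c \in components -> 0 < q c <= cycle_limit c.

Definition fcmj_objective (q : cycle_times) : rat :=
  (\sum_(c in components) setup_cost c / (q c)%:R +
   \sum_(m in modules) setup_cost m *
     \sum_(C : {set 'I_(node_count x)}
           | (C != set0) && (C \subset child_components m))
       (-1) ^+ (#|C|.+1) / (\big[lcmn/1]_(c in C) q c)%N%:R)%R.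

(* Number of nodes, root, adjacency matrix by rows, cycle limits of the
   components, then numerators and denominators of all setup costs. *)
Definition fcmj_encode_instance : seq nat :=
  [:: node_count x, val (@root x)
    & [seq nat_of_bool (@edge x u v) | u <- enum 'I_(node_count x),
                                       v <- enum 'I_(node_count x)]
   ++ [seq @cycle_limit x c | c <- enum components]
   ++ flatten [seq [:: `|numq (@setup_cost x v)|%N; `|denq (@setup_cost x v)|%N]
              | v <- enum 'I_(node_count x)]].

Definition fcmj_encode_solution (q : cycle_times) : seq nat :=
  [seq q c | c <- enum components].

End Fcmj.

Definition FCMJ : minimization_problem :=
  MinimizationProblem fcmj_feasible fcmj_objective
    fcmj_encode_instance fcmj_encode_solution.

Definition one_module_two_components (x : instance FCMJ) : Prop :=
  #|modules x| = 1 /\ #|components x| = 2.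

(* Main.v *)
From HB Require Import structures.
From mathcomp Require Import all_boot all_order all_algebra.
From mathcomp Require Import zify ring lra.
Require Import Defs.

Set Implicit Arguments.
Unset Strict Implicit.
Unset Printing Implicit Defensive.

Import Order.TTheory GRing.Theory Num.Theory.

(** Why factoring reduces to two-component maintenance.

    For [M > 1] consider the module with setup cost [1] and two components, the
    first with cycle limit [M] and setup cost [M], the second with cycle limit
    [maxn (M - 2) 1] and setup cost [0].  The first cost is large enough to
    force [q1 = M] in every optimal solution ([star_value_first]).  With
    [g = gcdn M q2], what then depends on [q2] is
      1 / q2 - 1 / lcmn M q2 = (M - g) / (M * q2),
    and this is at most [1 / M] exactly when [M - q2 <= g] ([star_value_second]).
    Since [g] divides [M - q2], that means that the gap [M - q2] divides [M].
    For [M > 2] the second cycle limit keeps the gap at least [2], so [1 / M] is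
    reached exactly when [M] has a nontrivial divisor, and then each optimal
    solution has such a divisor as its gap ([factoring_instance_optimal]).  For
    [M = 2] the gap is [1].  In either case a gap that is no nontrivial divisor
    proves that [M] is prime, so one query both tests primality and splits [M].

    The program keeps two numbers, [cur] and [rest], whose product with the
    output is the input.  A query on [cur] either shows that [cur] is prime, in
    which case it is output and replaced by [rest], or replaces [cur] by a
    nontrivial divisor and moves the cofactor into [rest].  With this bookkeeping no
    stack is needed.  The number of rounds is quadratic in the bit length of the
    input ([potential]), and no number larger than the input ever occurs, so
    each round costs a constant times that bit length; the total time is
    cubic ([factoring_loop_runs]).

    The queries are all of the special shape, so the restricted problem is
    integer-factorization hard, and an oracle for the full problem is in
    particular one for the restricted problem ([hard_of_restrict]). *)

(** * A module with two components *)

Section Star.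

Definition child1 : 'I_3 := Ordinal (isT : 1 < 3).
Definition child2 : 'I_3 := Ordinal (isT : 2 < 3).

Definition star_edge : rel 'I_3 := fun u v => (u == ord0) && (v != ord0).
Definition star_limit f1 f2 (v : 'I_3) : nat := if v == child1 then f1 else f2.
Definition star_cost (K0 K1 K2 : nat) (v : 'I_3) : rat :=
  (nth 0%N [:: K0; K1; K2] v)%:R%R.

Lemma enum_I3 : enum 'I_3 = [:: ord0; child1; child2].
Proof. by apply: (inj_map val_inj); rewrite val_enum_ord. Qed.

Lemma star_leaves : leaves star_edge = [set child1; child2].
Proof.
apply/setP=> v; rewrite !inE; apply/forallP/idP => [/(_ child1) | hv w].
- by case: v => [[|[|[]]]].
- by rewrite /star_edge; move: hv; case: v => [[|[|[]]]].
Qed.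

Lemma star_arborescence : arborescence star_edge ord0.
Proof.
apply/andP; split; apply/forallP => v.
- have [-> | v0] := eqVneq v ord0; first exact: connect0.
  by apply: connect1; rewrite /star_edge v0.
- have [-> | v0] := eqVneq v ord0.
    by rewrite cards_eq0; apply/eqP/setP => u; rewrite !inE /star_edge eqxx andbF.
  rewrite (_ : [set u | _] = [set ord0]) ?cards1 //.
  by apply/setP => u; rewrite !inE /star_edge v0 andbT.
Qed.

Lemma star_root : ord0 \notin leaves star_edge.
Proof. by rewrite star_leaves !inE. Qed.

Lemma star_limit_gt0 f1 f2 : 0 < f1 -> 0 < f2 ->
  forall c, c \in leaves star_edge -> 0 < star_limit f1 f2 c.
Proof. by move=> f1_gt0 f2_gt0 c _; rewrite /star_limit; case: ifP. Qed.

Lemma star_cost_ge0 K0 K1 K2 v : (0 <= star_cost K0 K1 K2 v)%R.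
Proof. exact: ler0n. Qed.

Variables (f1 f2 K0 K1 K2 : nat) (f1_gt0 : 0 < f1) (f2_gt0 : 0 < f2).

Definition star : fcmj_instance :=
  FcmjInstance star_arborescence star_root
    (star_limit_gt0 f1_gt0 f2_gt0) (star_cost_ge0 K0 K1 K2).

Lemma star_components : components star = [set child1; child2].
Proof. exact: star_leaves. Qed.

Lemma star_modules : modules star = [set ord0].
Proof.
rewrite /modules star_components; apply/setP => v; rewrite !inE.
by case: v => [[|[|[]]]].
Qed.

Lemma star_restricted : one_module_two_components star.
Proof. by split; rewrite ?star_modules ?star_components ?cards1 ?cards2. Qed.

Lemma enum_star_components : enum (components star) = [:: child1; child2].
Proof.
rewrite star_components {1}/enum_mem -enumT.
by rewrite enum_I3 /= !inE.
Qed.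

Lemma encode_star : fcmj_encode_instance star =
  [:: 3; 0; 0; 1; 1; 0; 0; 0; 0; 0; 0; f1; f2; K0; 1; K1; 1; K2; 1].
Proof.
rewrite /fcmj_encode_instance enum_star_components /= enum_I3 /=.
by rewrite /star_cost /= !pmulrn !numq_int !denq_int !absz_nat.
Qed.

Lemma encode_star_solution (q : cycle_times star) :
  fcmj_encode_solution q = [:: q child1; q child2].
Proof. by rewrite /fcmj_encode_solution enum_star_components. Qed.

Lemma star_feasibleP (q : cycle_times star) :
  fcmj_feasible q <-> 0 < q child1 <= f1 /\ 0 < q child2 <= f2.
Proof.
rewrite /fcmj_feasible star_components; split => [hq | [h1 h2] c].
  by split; apply: hq; rewrite !inE.
by rewrite !inE => /orP[] /eqP->.
Qed.

Definition star_value (q1 q2 : nat) : rat :=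
  (K1%:R / q1%:R + K2%:R / q2%:R
   + K0%:R * (q1%:R^-1 + q2%:R^-1 - (lcmn q1 q2)%:R^-1))%R.

(** Inclusion-exclusion has three terms here: the nonempty sets of children are
    the two singletons and the pair. *)
Lemma star_objective (q : cycle_times star) :
  fcmj_objective q = star_value (q child1) (q child2).
Proof.
have children : child_components (x := star) ord0 = [set child1; child2].
  by apply/setP => v; rewrite inE star_components !inE; case: v => [[|[|[]]]].
have subsets (C : {set 'I_3}) :
    (C != set0) && (C \subset [set child1; child2]) =
    (C \in [set [set child1]; [set child2]; [set child1; child2]]).
  apply/andP/idP => [[C0 /subsetP sC] |].
    have C00 : ord0 \in C = false by apply/negP => /sC; rewrite !inE.
    have sgP (D : {set 'I_3}) : (ord0 \in D) = false ->
        (child1 \in D) = (child1 \in C) -> (child2 \in D) = (child2 \in C) -> C = D.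
      move=> D0 D1 D2; apply/setP => v.
      have : v \in enum 'I_3 by rewrite mem_enum.
      by rewrite enum_I3 !inE => /or3P[] /eqP->; rewrite ?C00 ?D0 ?D1 ?D2.
    rewrite !inE; case C1 : (child1 \in C); case C2 : (child2 \in C).
    - by rewrite (sgP [set child1; child2]) ?eqxx ?orbT // !inE ?C1 ?C2.
    - by rewrite (sgP [set child1]) ?eqxx ?orbT // !inE ?C1 ?C2.
    - by rewrite (sgP [set child2]) ?eqxx ?orbT // !inE ?C1 ?C2.
    - by rewrite (sgP set0) ?eqxx ?inE ?C1 ?C2 // in C0.
  by rewrite !inE => /orP[/orP[]|] /eqP->; split; rewrite ?subsetUl ?subsetUr //;
    apply/set0Pn; [exists child1 | exists child2 | exists child1]; rewrite !inE.
rewrite /fcmj_objective star_components star_modules big_set1 children.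
rewrite (eq_bigl _ _ subsets).
rewrite -setUA !big_setU1 ?big_set1 ?inE //=; first last.
- by apply/norP; split; apply/eqP => /setP/(_ child2); rewrite !inE.
- by apply/eqP => /setP/(_ child1); rewrite !inE.
rewrite big_setU1 ?big_set1 ?inE //= !cards1 cards2 /star_value /star_cost /=.
by rewrite !exprS expr0; ring.
Qed.

End Star.

(** * Optimal solutions reveal divisors *)

Lemma gcdn_sub_dvd M q : q <= M -> gcdn M q %| M - q.
Proof. by move=> qM; rewrite dvdn_subr ?dvdn_gcdr ?dvdn_gcdl. Qed.

Section StarValue.

Local Open Scope ring_scope.

(** Raising [q1] to [M] saves at least [(M + 1) / (M * q1)] in the terms
    [1 / q1], which exceeds the loss, at most [1 / lcmn q1 q2 <= 1 / q1], in the
    term of the joint maintenance. *)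
Lemma star_value_first M q1 q2 : (0 < q1 < M)%N -> (0 < q2)%N ->
  star_value 1 M 0 M q2 < star_value 1 M 0 q1 q2.
Proof.
move=> /andP[q1_gt0 q1M] q2_gt0.
have q1_le_lcm : (q1 <= lcmn q1 q2)%N by rewrite dvdn_leq ?dvdn_lcml ?lcmn_gt0 ?q1_gt0.
have lcm_gt0 : (0 < lcmn M q2)%N by rewrite lcmn_gt0 q2_gt0 (ltn_trans q1_gt0).
rewrite /star_value !mul1r !mul0r.
have a0 : 0 < q1%:R :> rat by rewrite ltr0n.
have b0 : 0 < M%:R :> rat by rewrite ltr0n (ltn_trans q1_gt0).
have ab : q1%:R + 1 <= M%:R :> rat by rewrite natr1 ler_nat.
have l1 : (lcmn q1 q2)%:R^-1 <= q1%:R^-1 :> rat.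
  by rewrite lef_pV2 ?posrE ?ltr0n ?ler_nat // lcmn_gt0 q1_gt0.
have l2 : 0 < (lcmn M q2)%:R^-1 :> rat by rewrite invr_gt0 ltr0n.
have l3 : 1 + q1%:R^-1 <= M%:R / q1%:R :> rat.
  rewrite (_ : 1 + q1%:R^-1 = (q1%:R + 1) / q1%:R); last by field; rewrite lt0r_neq0.
  by rewrite ler_pM2r ?invr_gt0.
have l4 : M%:R^-1 < q1%:R^-1 :> rat by rewrite ltf_pV2 ?posrE // ltr_nat.
have -> : M%:R / M%:R = 1 :> rat by rewrite divff ?lt0r_neq0.
lra.
Qed.

(** The part of the value that depends on [q] is [(M - gcdn M q) / (M * q)], and
    clearing denominators in its comparison with [1 / M] gives
    [M - gcdn M q <= q]. *)
Lemma star_value_second M q : (0 < q < M)%N ->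
  (star_value 1 M 0 M q <= 1 + M%:R^-1 + M%:R^-1) = (M - q <= gcdn M q)%N.
Proof.
move=> /andP[q_gt0 qM]; have M_gt0 := ltn_trans q_gt0 qM.
have g0 : (0 < gcdn M q)%N by rewrite gcdn_gt0 M_gt0.
have Mr : 0 < M%:R :> rat by rewrite ltr0n.
have qr : 0 < q%:R :> rat by rewrite ltr0n.
have -> : star_value 1 M 0 M q =
    1 + M%:R^-1 + (M%:R - (gcdn M q)%:R) / (M%:R * q%:R).
  have lr : (lcmn M q)%:R = M%:R * q%:R / (gcdn M q)%:R :> rat.
    by rewrite -natrM -muln_lcm_gcd natrM mulfK // pnatr_eq0 -lt0n.
  rewrite /star_value lr; field.
  by rewrite !pnatr_eq0 -!lt0n M_gt0 q_gt0 g0.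
rewrite lerD2l ler_pdivrMr ?mulr_gt0 // mulKf ?lt0r_neq0 //.
by rewrite lerBlDl -natrD ler_nat leq_subLR addnC.
Qed.

End StarValue.

(** The maximum with 1 keeps the limit positive for [M = 2]. *)
Lemma factoring_limit_gt0 M : 0 < maxn (M - 2) 1.
Proof. by rewrite leq_max orbT. Qed.

Definition factoring_instance M (M_gt0 : 0 < M) : fcmj_instance :=
  star 1 M 0 M_gt0 (factoring_limit_gt0 M).

Lemma composite_nontrivial_divisor M : 1 < M -> ~~ prime M ->
  exists2 d, 1 < d < M & d %| M.
Proof.
move=> M_gt1 /primePn[|[d dM dvd]]; first by rewrite ltnNge M_gt1.
by exists d.
Qed.

(** A nontrivial divisor [d] of [M] makes [M - d] a competitor of value at most
    [1 + 2 / M].  The optimal [q child2] is then at least as good, so its gap to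
    [M] is at most [gcdn M (q child2)], which divides the gap: the two are
    equal. *)
Lemma factoring_instance_optimal M (M_gt0 : 0 < M) (M_gt1 : 1 < M)
    (q : cycle_times (factoring_instance M_gt0)) :
  optimal (P := FCMJ) (x := factoring_instance M_gt0) q ->
  [/\ q child1 = M, 0 < q child2 < M
    & ~~ prime M -> 1 < M - q child2 /\ M - q child2 %| M].
Proof.
case=> /star_feasibleP[/andP[q1_gt0 q1M] /andP[q2_gt0 q2M]] q_min.
have best r1 r2 : 0 < r1 <= M -> 0 < r2 <= maxn (M - 2) 1 ->
    (star_value 1 M 0 (q child1) (q child2) <= star_value 1 M 0 r1 r2)%R.
  move=> hr1 hr2; pose r v := if v == child1 then r1 else r2.
  by have := q_min r; rewrite /= !star_objective; apply; apply/star_feasibleP.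
have eq_q1 : q child1 = M.
  apply/eqP; rewrite eqn_leq q1M leqNgt; apply/negP => q1_lt.
  have := best M (q child2); rewrite leqnn M_gt0 q2_gt0 q2M => /(_ isT isT).
  by rewrite leNgt star_value_first // q1_gt0.
have q2_lt : 0 < q child2 < M.
  by rewrite q2_gt0 (leq_ltn_trans q2M) // gtn_max M_gt1 andbT; lia.
split=> // /(composite_nontrivial_divisor M_gt1)[d /andP[d_gt1 dM] d_dvd].
have d2M : M - d <= M - 2 by rewrite leq_sub2l.
have Md_lt : 0 < M - d < M by lia.
have d_le_gcd : M - (M - d) <= gcdn M (M - d).
  rewrite (subKn (ltnW dM)) dvdn_leq ?gcdn_gt0 ?M_gt0 //.
  by rewrite dvdn_gcd d_dvd dvdn_sub.
have le_gcd : M - q child2 <= gcdn M (q child2).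
  rewrite -star_value_second //; have := best M (M - d); rewrite eq_q1 => best_d.
  apply: (le_trans (best_d _ _)).
  - by rewrite M_gt0 leqnn.
  - by rewrite leq_max d2M; case/andP: Md_lt => ->.
  - by rewrite star_value_second.
have q2_le : q child2 <= M by case/andP: q2_lt => _ /ltnW.
have eq_gcd : M - q child2 = gcdn M (q child2).
  apply/eqP; rewrite eqn_leq le_gcd dvdn_leq ?gcdn_sub_dvd // subn_gt0.
  by case/andP: q2_lt.
split; last by rewrite eq_gcd dvdn_gcdl.
by move: q2M; rewrite leq_max; lia.
Qed.

(** * Time bounds for loop-free programs *)

Fixpoint expr_size (e : expr) : nat :=
  match e with
  | Const _ => 1
  | Cell a => (expr_size a).+1
  | Bin _ e1 e2 => (expr_size e1 + expr_size e2).+1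
  end.

(** All intermediate values are bounded, not only the result, because every
    subexpression is charged the bit length of its value. *)
Fixpoint values_le (N : nat) (h : memory) (e : expr) : bool :=
  (eval h e <= N) &&
  match e with
  | Const _ => true
  | Cell a => values_le N h a
  | Bin _ e1 e2 => values_le N h e1 && values_le N h e2
  end.

Lemma leq_bitlen m n : m <= n -> bitlen m <= bitlen n.
Proof. by move=> mn; rewrite ltnS leq_trunc_log. Qed.

Lemma expr_cost_le N h e :
  values_le N h e -> expr_cost h e <= expr_size e * bitlen N.
Proof.
elim: e => [n|a IH|o e1 IH1 e2 IH2] /= /andP[/leq_bitlen le_val].
- by rewrite addn0 mul1n.
- by move=> /IH le_a; rewrite mulSn leq_add.
- by move=> /andP[/IH1 le1 /IH2 le2]; rewrite mulSn mulnDl !leq_add.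
Qed.

(** An upper bound for the time of a loop-free command in units of the bit length
    of the largest number handled.  The two branches of a conditional are added
    rather than compared, which only loses a constant.  The value of a loop is a
    dummy: it is below every execution time of the loop. *)
Fixpoint unit_cost (c : command) : nat :=
  match c with
  | Skip | Query => 1
  | Store a e => (expr_size a + expr_size e).+1
  | Seq c1 c2 => unit_cost c1 + unit_cost c2
  | If e c1 c2 => (expr_size e).+1 + (unit_cost c1 + unit_cost c2)
  | While _ _ => 0
  | Send e | Output e => (expr_size e).+1
  | Receive a => (expr_size a).+2
  end.

Section Runs.

Variables (O : oracle) (N : nat).

Definition runs c s s' := exists2 t, exec O c s t s' & t <= unit_cost c * bitlen N.

Lemma runs_skip s : runs Skip s s.
Proof. by exists 1; [exact: ExecSkip | rewrite mul1n]. Qed.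

Lemma runs_store a e h qu an ou ca :
  values_le N h a -> values_le N h e ->
  runs (Store a e) (State h qu an ou ca)
    (State (write h (eval h a) (eval h e)) qu an ou ca).
Proof.
move=> /expr_cost_le ha /expr_cost_le he; eexists; first exact: ExecStore.
by rewrite /= mulSn mulnDl -addnA !leq_add.
Qed.

Lemma runs_seq c d s1 s2 s3 :
  runs c s1 s2 -> runs d s2 s3 -> runs (Seq c d) s1 s3.
Proof.
move=> [t1 r1 le1] [t2 r2 le2]; exists (t1 + t2); first exact: ExecSeq r1 r2.
by rewrite /= mulnDl leq_add.
Qed.

Lemma runs_if e c d s s' :
  values_le N (mem s) e ->
  runs (if eval (mem s) e != 0 then c else d) s s' ->
  runs (If e c d) s s'.
Proof.
move=> /expr_cost_le he [t r le_t]; eexists; first exact: ExecIf r.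
rewrite /= mulnDl leq_add ?mulSn ?leq_add //; apply: leq_trans le_t _.
by rewrite leq_mul2r; case: ifP => _; rewrite ?leq_addr ?leq_addl orbT.
Qed.

Lemma runs_send e h qu an ou ca :
  values_le N h e ->
  runs (Send e) (State h qu an ou ca) (State h (rcons qu (eval h e)) an ou ca).
Proof.
move=> /expr_cost_le he; eexists; first exact: ExecSend.
by rewrite /= mulSn leq_add.
Qed.

Lemma runs_query h qu an ou ca :
  runs Query (State h qu an ou ca) (State h [::] (O qu) ou (rcons ca qu)).
Proof. by exists 1; [exact: ExecQuery | rewrite mul1n]. Qed.

Lemma runs_receive a h qu x an ou ca :
  values_le N h a -> x <= N ->
  runs (Receive a) (State h qu (x :: an) ou ca)
    (State (write h (eval h a) x) qu an ou ca).
Proof.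
move=> /expr_cost_le ha /leq_bitlen hx; eexists; first exact: ExecReceive.
by rewrite /= mulSn -addnA leq_add // mulSn addnC leq_add.
Qed.

Lemma runs_output e h qu an ou ca :
  values_le N h e ->
  runs (Output e) (State h qu an ou ca) (State h qu an (rcons ou (eval h e)) ca).
Proof.
move=> /expr_cost_le he; eexists; first exact: ExecOutput.
by rewrite /= mulSn leq_add.
Qed.

Definition sends (es : seq expr) : command := foldr (fun e => Seq (Send e)) Skip es.

Lemma runs_sends es h qu an ou ca :
  all (values_le N h) es ->
  runs (sends es) (State h qu an ou ca) (State h (qu ++ map (eval h) es) an ou ca).
Proof.
elim: es qu => [|e es IH] qu /=; first by rewrite cats0 => _; exact: runs_skip.
move=> /andP[he hes]; apply: runs_seq (runs_send _ _ _ _ he) _.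
by rewrite -cat_rcons; exact: IH.
Qed.

End Runs.

(** * The factoring program *)

Definition cur : expr := Cell (Const 0).
Definition rest : expr := Cell (Const 1).
Definition gap : expr := Cell (Const 2).

(** [encode_star] for the costs and limits of [factoring_instance M], as a total
    function of [M]. *)
Definition factoring_query (M : nat) : seq nat :=
  [:: 3; 0; 0; 1; 1; 0; 0; 0; 0; 0; 0; M; maxn (M - 2) 1; 1; 1; M; 1; 0; 1].

(** [maxn (cur - 2) 1], written as in [maxnE]. *)
Definition limit_expr : expr :=
  let e := Bin Sub cur (Const 2) in Bin Add e (Bin Sub (Const 1) e).

Definition query_exprs : seq expr :=
  map Const [:: 3; 0; 0; 1; 1; 0; 0; 0; 0; 0; 0] ++
  [:: cur; limit_expr; Const 1; Const 1; cur; Const 1; Const 0; Const 1].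

(** The answer consists of [q1] and [q2]; receiving both into the same cell
    discards [q1].  The tested sum vanishes exactly when the gap divides [cur] and
    is at least [2]; the second condition matters for [cur = 2], where the gap
    is [1]. *)
Definition split_step : command :=
  Seq (sends query_exprs) (Seq Query (Seq (Receive (Const 2)) (Seq (Receive (Const 2))
  (Seq (Store (Const 2) (Bin Sub cur gap))
  (If (Bin Add (Bin Mod cur gap) (Bin Sub (Const 2) gap))
    (Seq (Output cur) (Seq (Store (Const 0) rest) (Store (Const 1) (Const 1))))
    (Seq (Store (Const 1) (Bin Mul rest (Bin Div cur gap)))
         (Store (Const 0) gap))))))).

Definition factoring_prog : command :=
  Seq (Store (Const 1) (Const 1)) (While (Bin Sub cur (Const 1)) split_step).

(** What the program uses of its oracle.  For prime [M] the range of [q] alone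
    makes the test of [split_step] come out right: no gap of size at least [2]
    and below [M] divides [M]. *)
Definition reveals_divisor (O : oracle) := forall M, 1 < M ->
  exists q, [/\ O (factoring_query M) = [:: M; q], 0 < q < M
              & ~~ prime M -> 1 < M - q /\ M - q %| M].

(** One round.  The first alternative is correct because [reveals_divisor] would
    provide a nontrivial divisor for composite [m]; the second because the program
    has itself checked divisibility. *)
Lemma split_step_runs O N m r h an ou ca : reveals_divisor O ->
  2 < N -> 1 < m -> 0 < r -> m * r <= N -> h 0 = m -> h 1 = r ->
  exists h' an' m' r' ou',
  [/\ runs O N split_step (State h [::] an ou ca)
        (State h' [::] an' ou' (rcons ca (factoring_query m))),
      h' 0 = m', h' 1 = r'
    & [/\ prime m, ou' = rcons ou m, m' = r & r' = 1] \/
      [/\ ou' = ou, 1 < m' < m, m' %| m & r' = r * (m %/ m')]].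
Proof.
move=> ora N_gt2 m_gt1 r_gt0 mrN h0 h1.
have mN : m <= N by rewrite (leq_trans _ mrN) // leq_pmulr.
have rN : r <= N by rewrite (leq_trans _ mrN) // leq_pmull // ltnW.
have N1 : 1 < N by lia.
have N0 : 0 < N by lia.
have [q [Oq /andP[q_gt0 qm] split_q]] := ora m m_gt1.
have qN : q <= N by lia.
have modN : m %% (m - q) + (2 - (m - q)) <= N.
  have : m %% (m - q) < m - q by rewrite ltn_mod subn_gt0.
  by lia.
pose composite_q := (m %% (m - q) + (2 - (m - q)) == 0).
pose h2 := write (write (write h 2 m) 2 q) 2 (m - q).
(* Both alternatives share the steps up to the conditional. *)
have enter s' :
    runs O N (if ~~ composite_q then
      Seq (Output cur) (Seq (Store (Const 0) rest) (Store (Const 1) (Const 1)))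
    else (Seq (Store (Const 1) (Bin Mul rest (Bin Div cur gap)))
         (Store (Const 0) gap)))
      (State h2 [::] [::] ou (rcons ca (factoring_query m))) s' ->
    runs O N split_step (State h [::] an ou ca) s'.
  move=> final.
  apply: runs_seq.
    apply: runs_sends; rewrite /= h0; lia.
  apply: runs_seq; first exact: runs_query.
  have -> : [::] ++ map (eval h) query_exprs = factoring_query m.
    by rewrite /factoring_query /= h0 -maxnE.
  rewrite Oq.
  apply: runs_seq; first by apply: runs_receive => //=; lia.
  apply: runs_seq; first by apply: runs_receive => //=; lia.
  apply: runs_seq; first by apply: runs_store => /=; rewrite /write /= ?h0; lia.
  apply: runs_if; first by rewrite /= /write /= h0; lia.
  by rewrite /= /write /= h0; exact: final.
case: (boolP composite_q) enter => [cq | prime_q] enter.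
- have [gap_gt1 gap_dvd] : 1 < m - q /\ m - q %| m by rewrite /dvdn; lia.
  have divN : m %/ (m - q) <= m by exact: leq_div.
  have rdivN : r * (m %/ (m - q)) <= N.
    by rewrite (leq_trans _ mrN) // mulnC leq_mul2r divN orbT.
  exists (write (write h2 1 (r * (m %/ (m - q)))) 0 (m - q)), [::].
  exists (m - q), (r * (m %/ (m - q))), ou; split=> //.
    apply: enter; rewrite /= -/h2.
    subst m r; apply: runs_seq; apply: runs_store => //=; rewrite /h2 /write /=; lia.
  by right; split=> //; rewrite gap_gt1 /=; lia.
- exists (write (write h2 0 r) 1 1), [::], r, 1, (rcons ou m); split=> //.
    apply: enter; rewrite /=; subst m r.
    apply: runs_seq; first by apply: runs_output => /=; rewrite /h2 /write /=; lia.
    by apply: runs_seq; apply: runs_store => //=; rewrite /h2 /write /=; lia.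
  left; split => //; apply: contraR prime_q => /split_q[gap_gt1 /eqP gap_dvd].
  by rewrite /composite_q gap_dvd; lia.
Qed.

Lemma trunc_log_double m n : 0 < m -> 2 * m <= n ->
  trunc_log 2 m < trunc_log 2 n.
Proof.
move=> m_gt0 le_mn.
by rewrite -trunc_log2_double // leq_trunc_log // -mul2n.
Qed.

(** Outputting a prime lowers [trunc_log 2 (m * r)]; the weight [L.+1] outweighs
    the possible growth of the second term, which stays at most [L] when [L] is
    the logarithm of the input.  Splitting keeps [m * r] and lowers
    [trunc_log 2 m]. *)
Definition potential (L m r : nat) : nat :=
  L.+1 * trunc_log 2 (m * r) + trunc_log 2 m.

(** The current number is [1] only when everything is output: the hypothesis
    [m = 1 -> r = 1] is what makes the loop condition a correct test.  In the
    time bound, the guard costs at most [5] units in each evaluation. *)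
Lemma factoring_loop_runs O N f m r h an ou ca : reveals_divisor O ->
  2 < N -> 0 < m -> 0 < r -> (m = 1 -> r = 1) -> m * r <= N ->
  h 0 = m -> h 1 = r ->
  potential (trunc_log 2 N) m r <= f ->
  exists t s' fs qs,
  [/\ exec O (While (Bin Sub cur (Const 1)) split_step)
        (State h [::] an ou ca) t s',
      t <= (f * (unit_cost split_step + 5) + 5) * bitlen N,
      output s' = ou ++ fs /\ prime_factorization (m * r) fs
    & calls s' = ca ++ qs /\ (1 < m -> qs != [::]) /\
      forall qu, qu \in qs -> exists2 M, 1 < M & qu = factoring_query M].
Proof.
move=> ora N_gt2.
elim: f m r h an ou ca => [|f IH] m r h an ou ca m_gt0 r_gt0 m1r1 mrN h0 h1 pot.
all: have mN : m <= N by rewrite (leq_trans _ mrN) // leq_pmulr.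
all: have guard : 1 + expr_cost h (Bin Sub cur (Const 1)) <= 5 * bitlen N
  by rewrite (mulnDl 1 4) leq_add // ?mul1n // expr_cost_le //= h0; lia.
all: have [m_le1 | m_gt1] := leqP m 1.
(* For [m = 1] the loop stops at once, whatever the potential. *)
1, 3: have eq_m : m = 1 by [lia]; have eq_r := m1r1 eq_m;
  exists (1 + expr_cost h (Bin Sub cur (Const 1))), (State h [::] an ou ca), [::], [::];
  split; rewrite ?cats0 ?eq_m ?eq_r //=;
  by [apply: ExecWhileDone; rewrite /= h0 eq_m
     | rewrite (leq_trans guard) // leq_mul2r leq_addl orbT
     | rewrite /prime_factorization big_nil].
(* A vanishing potential excludes [m > 1]. *)
  move: pot; rewrite leqn0 /potential addn_eq0 trunc_log_eq0 => /andP[_].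
  by rewrite /= leqNgt m_gt1.
have [h' [an' [m' [r' [ou' [[t1 body le_t1] h'0 h'1 progress]]]]]] :=
  split_step_runs an ou ca ora N_gt2 m_gt1 r_gt0 mrN h0 h1.
(* A round preserves the invariants and lowers the potential. *)
have [m'_gt0 r'_gt0 m'1r'1 m'r'N pot'] :
    [/\ 0 < m', 0 < r', m' = 1 -> r' = 1, m' * r' <= N
      & potential (trunc_log 2 N) m' r' <= f].
  case: progress => [[m_prime _ -> ->] | [_ /andP[m'_gt1 m'_lt] m'_dvd ->]].
    split=> //; first by rewrite muln1 (leq_trans _ mrN) // leq_pmull.
    rewrite -ltnS; apply: leq_trans pot; rewrite /potential muln1.
    have lt_r : trunc_log 2 r < trunc_log 2 (m * r).
      by rewrite trunc_log_double // leq_mul2r m_gt1 orbT.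
    have le_rN : trunc_log 2 r <= trunc_log 2 N.
      by rewrite leq_trunc_log // (leq_trans _ mrN) // leq_pmull.
    by nia.
  have mE : m' * (r * (m %/ m')) = m * r.
    by rewrite mulnCA [m' * _]mulnC divnK // mulnC.
  have m'_gt0 := ltnW m'_gt1.
  split=> //; rewrite ?mE //.
  - by rewrite muln_gt0 r_gt0 divn_gt0 // ltnW.
  - by move=> m'1; rewrite m'1 in m'_gt1.
  - rewrite -ltnS; apply: leq_trans pot; rewrite /potential mE ltn_add2l trunc_log_double //.
    by rewrite -[X in _ <= X](divnK m'_dvd) leq_mul2r ltn_divRL // mul1n m'_lt orbT.
have [t2 [s' [fs [qs [loop le_t2 [out_fs fs_prime] [calls_qs [_ qs_ok]]]]]]] :=
  IH m' r' h' an' ou' (rcons ca (factoring_query m))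
     m'_gt0 r'_gt0 m'1r'1 m'r'N h'0 h'1 pot'.
have [fs' out_fs'] :
    exists fs', output s' = ou ++ fs' /\ prime_factorization (m * r) fs'.
  case: progress => [[m_prime eq_ou eq_m' eq_r'] | [eq_ou _ m'_dvd eq_r']].
    exists (m :: fs); rewrite out_fs eq_ou cat_rcons; split=> //.
    move: fs_prime; rewrite eq_m' eq_r' muln1 /prime_factorization /= m_prime big_cons.
    by move=> /andP[-> /eqP->] /=.
  exists fs; rewrite out_fs eq_ou; split=> //; move: fs_prime.
  by rewrite eq_r' mulnCA [m' * _]mulnC divnK // mulnC.
exists (1 + expr_cost h (Bin Sub cur (Const 1)) + t1 + t2), s'.
exists fs', (factoring_query m :: qs); split=> //.
- by apply: ExecWhileStep body loop; rewrite /= h0 subn_eq0 -ltnNge.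
- by nia.
- rewrite calls_qs cat_rcons; split=> //; split=> // qu.
  by rewrite inE => /predU1P[-> | /qs_ok //]; exists m.
Qed.

(** * Hardness *)

Lemma oracle_reveals_divisor O :
  solves (restrict one_module_two_components) O -> reveals_divisor O.
Proof.
move=> solO M M_gt1; have M_gt0 := ltnW M_gt1.
have [q [q_opt]] := solO (exist _ _
  (star_restricted 1 M 0 M_gt0 (factoring_limit_gt0 M))).
rewrite /= encode_star encode_star_solution => Oq.
have [q1M q2M q_dvd] := factoring_instance_optimal M_gt1 q_opt.
by exists (q child2); rewrite -[X in [:: X; _]]q1M.
Qed.

(** The same program works: an oracle for the full problem also solves the
    restricted one, and restricted instances are instances. *)
Lemma hard_of_restrict (P : minimization_problem) (D : instance P -> Prop) :
  integer_factorization_hard (restrict D) -> integer_factorization_hard P.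
Proof.
case=> prog [p hard]; exists prog, p => O solO n n_comp.
have solDO : solves (restrict D) O by move=> [x Dx]; exact: solO.
have [t [s [run out le_t called calls_ok]]] := hard O solDO n n_comp.
by exists t, s; split=> // qu /calls_ok[[y Dy] ->]; exists y.
Qed.

Lemma composite_gt3 n : composite n -> 3 < n.
Proof. by case: n => [|[|[|[|n]]]]. Qed.

Lemma horner_cubic (c x : nat) :
  ((c%:P * ('X + 1) ^+ 3).[x])%R = c * x.+1 ^ 3.
Proof. by rewrite hornerM hornerC horner_exp hornerD hornerX hornerC natrDE addn1. Qed.

(** There are at most [L.+1 * L + L < L.+1 ^ 2] rounds; the [9] in the polynomial
    covers the loop guards and the initialization of [rest]. *)
Lemma restricted_fcmj_hard :
  integer_factorization_hard (restrict one_module_two_components).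
Proof.
pose C := unit_cost split_step + 9.
exists factoring_prog, (C%:P * ('X + 1) ^+ 3)%R.
move=> O /oracle_reveals_divisor ora n /composite_gt3 n_gt3.
have n_gt0 : 0 < n by lia.
set L := trunc_log 2 n.
have one_le_n : values_le n (mem (start n)) (Const 1) by rewrite /= n_gt0.
have [t1 init le_t1] := runs_store O [::] [::] [::] [::] one_le_n one_le_n.
have pot : potential L n 1 <= L.+1 * L + L by rewrite /potential muln1.
have [t2 [s [fs [qs [loop le_t2 [out_fs fs_prime] [calls_qs [qs_nil qs_ok]]]]]]] :=
  @factoring_loop_runs O n _ n 1 (write (mem (start n)) 1 1) [::] [::] [::]
    ora (ltnW n_gt3) n_gt0 isT (fun _ => erefl) (eq_leq (muln1 n)) erefl erefl pot.
exists (t1 + t2), s; rewrite out_fs calls_qs !cat0s; split.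
- exact: ExecSeq init loop.
- by rewrite muln1 in fs_prime.
- rewrite -/L horner_cubic (leq_trans (leq_add le_t1 le_t2)) // -mulnDl /bitlen -/L.
  move: (unit_cost split_step) @C => U C; rewrite /C /=.
  by rewrite expnSr mulnA leq_mul2r /=; nia.
- by apply/eqP/qs_nil; lia.
- move=> qu /qs_ok[M M_gt1 ->]; have M_gt0 := ltnW M_gt1.
  exists (exist _ _ (star_restricted 1 M 0 M_gt0 (factoring_limit_gt0 M))).
  by rewrite /= encode_star.
Qed.

Theorem theorem3p1 :
  integer_factorization_hard FCMJ /\
  integer_factorization_hard (restrict one_module_two_components).
Proof.
split; last exact: restricted_fcmj_hard.
exact: hard_of_restrict restricted_fcmj_hard.
Qed.
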